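(* Let $K\subset S^3$ be a knot with Alexander polynomial $\Delta_K(t)=a_0+a_1\cdot(t+t^{-1})+\cdots+a_d\cdot(t^d+t^{-d})$. If the inequality $$|a_j|\geq |a_0|\cdot\cos\left(\frac{\pi}{\lfloor d/j\rfloor +2}\right)$$ holds for some $j\in\{1,\ldots,d\}$, then $\Delta_K$ has a zero of odd order on the complex unit circle.
   Context: $\Delta_K\in\mathbb{Z}[t,t^{-1}]$ is taken with the Conway normalization: $\Delta_K(t)=\Delta_K(t^{-1})$ and $\Delta_K(1)=1$. The notation $\lfloor x\rfloor$ denotes the greatest integer less than or equal to $x\in\mathbb{R}$. (One may assume $a_d\neq0$; otherwise the condition only becomes stronger.) *)

(* Defs.v *)
From HB Require Import structures.
From Stdlib Require Import Relation_Operators.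
From mathcomp Require Import all_boot all_order all_algebra.
From mathcomp Require Import fraction complex.
From mathcomp Require Import all_classical all_reals all_analysis.

Set Implicit Arguments.
Unset Strict Implicit.
Unset Printing Implicit Defensive.

Import Order.TTheory GRing.Theory Num.Theory.
Import numFieldNormedType.Exports.

Local Open Scope classical_set_scope.
Local Open Scope ring_scope.

Definition sphere3 (R : realType) : set 'rV[R]_4 :=
  [set x | \sum_(i < 4) x 0 i ^+ 2 = 1].

Definition smooth_curve (R : realType) (f : R -> 'rV[R]_4) : Prop :=
  forall (n : nat) (x : R), derivable (derive1n n f) x 1.

(* A knot is the image of a smooth embedding of the circle R/Z into S^3, that
   is, of a 1-periodic smooth regular curve which is injective modulo 1. *)
Definition is_knot (R : realType) (K : set 'rV[R]_4) : Prop :=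
  K `<=` @sphere3 R /\
  exists f : R -> 'rV[R]_4,
    [/\ smooth_curve f,
        forall x : R, derive1 f x != 0,
        forall x y : R, f x = f y <-> exists n : int, x - y = n%:~R
      & range f = K].

Definition knot_complement (R : realType) (K : set 'rV[R]_4) : set 'rV[R]_4 :=
  @sphere3 R `\` K.

(* Loops are functions on the real line; only their values on [0, 1] matter. *)
Section Loops.
Context {R : realType}.
Implicit Types (X : set 'rV[R]_4) (x : 'rV[R]_4) (f g : R -> 'rV[R]_4).

Definition is_loop X x f : Prop :=
  [/\ {within `[0, 1], continuous f},
      forall s : R, s \in `[0, 1] -> X (f s), f 0 = x & f 1 = x].

Definition loop_homotopic X x f g : Prop :=
  exists H : R * R -> 'rV[R]_4,
    [/\ {within `[0, 1] `*` `[0, 1], continuous H},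
        forall s u : R, s \in `[0, 1] -> u \in `[0, 1] -> X (H (s, u)),
        forall s : R, s \in `[0, 1] -> H (s, 0) = f s,
        forall s : R, s \in `[0, 1] -> H (s, 1) = g s
      & forall u : R, u \in `[0, 1] -> H (0, u) = x /\ H (1, u) = x].

Definition loop_cat f g : R -> 'rV[R]_4 :=
  fun s => if s <= 2^-1 then f (2 * s) else g (2 * s - 1).

Definition loop_inv f : R -> 'rV[R]_4 := fun s => f (1 - s).

End Loops.

(* A word in x_0, ..., x_(m-1): (i, true) stands for x_i and (i, false) for
   the inverse of x_i. *)
Definition word (m : nat) := seq ('I_m * bool).

Inductive word_step (m n : nat) (r : 'I_n -> word m) : word m -> word m -> Prop :=
| Word_cancel (u v : word m) (i : 'I_m) (b : bool) :
    word_step r (u ++ v) (u ++ (i, b) :: (i, ~~ b) :: v)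
| Word_relator (u v : word m) (k : 'I_n) :
    word_step r (u ++ v) (u ++ r k ++ v).

(* Equality in the group < x_0, ..., x_(m-1) | r_0, ..., r_(n-1) >. *)
Definition word_equiv (m n : nat) (r : 'I_n -> word m) : word m -> word m -> Prop :=
  clos_refl_sym_trans (word m) (word_step r).

Definition word_loop (R : realType) (m : nat) (x0 : 'rV[R]_4)
    (gen : 'I_m -> R -> 'rV[R]_4) (w : word m) : R -> 'rV[R]_4 :=
  foldr (fun l f => loop_cat (if l.2 then gen l.1 else loop_inv (gen l.1)) f)
        (cst x0) w.

(* x_i |-> [gen i] induces an isomorphism from < x | r > to pi_1(X, x0). *)
Definition presents_pi1 (R : realType) (X : set 'rV[R]_4) (x0 : 'rV[R]_4)
    (m n : nat) (gen : 'I_m -> R -> 'rV[R]_4) (r : 'I_n -> word m) : Prop :=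
  [/\ X x0,
      forall i, is_loop X x0 (gen i),
      forall f, is_loop X x0 f ->
        exists w : word m, loop_homotopic X x0 f (word_loop x0 gen w)
    & forall w : word m,
        loop_homotopic X x0 (word_loop x0 gen w) (cst x0) <->
        word_equiv r w [::]].

(* The image of a word under the homomorphism to Z with x_i |-> e i. *)
Definition word_exponent (m : nat) (e : 'I_m -> int) (w : word m) : int :=
  \sum_(l <- w) (if l.2 then e l.1 else - e l.1).

(* x_i |-> e i is well defined on < x | r > and maps onto Z.  As the first
   homology of a knot complement is Z, for a presentation of a knot group this
   is the abelianization, unique up to sign. *)
Definition abelianization_to_Z (m n : nat) (r : 'I_n -> word m)
    (e : 'I_m -> int) : Prop :=
  (forall k, word_exponent e (r k) = 0) /\
  (exists w : word m, word_exponent e w = 1).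

(* Laurent polynomials Z[t, t^-1] are the fractions p / t^k inside the field
   of fractions of Z[t]. *)
Notation Zt_frac := {fraction {poly int}}.

Definition tvar : Zt_frac := FracField.tofrac ('X : {poly int}).

Definition laurent (p : {poly int}) (k : nat) : Zt_frac :=
  FracField.tofrac p / tvar ^+ k.

Definition is_laurent (f : Zt_frac) : Prop :=
  exists (p : {poly int}) (k : nat), f = laurent p k.

(* The image in Z[t, t^-1] of the Fox derivative of w with respect to x_i,
   following d(x_j w) = delta_ij + x_j dw and
   d(x_j^-1 w) = - delta_ij x_j^-1 + x_j^-1 dw. *)
Fixpoint fox_derivative (m : nat) (e : 'I_m -> int) (i : 'I_m) (w : word m)
    : Zt_frac :=
  match w with
  | [::] => 0
  | (j, true) :: w' => (i == j)%:R + tvar ^ (e j) * fox_derivative e i w'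
  | (j, false) :: w' => tvar ^ (- e j) * (fox_derivative e i w' - (i == j)%:R)
  end.

Definition alexander_matrix (m n : nat) (r : 'I_n -> word m) (e : 'I_m -> int)
    : 'M[Zt_frac]_(n, m) :=
  \matrix_(k, i) fox_derivative e i (r k).

(* The choices of rows f and columns g need not be injective or increasing:
   the extra determinants are 0 or minors up to sign. *)
Definition alexander_minor (m n : nat) (r : 'I_n -> word m) (e : 'I_m -> int)
    (f : {ffun 'I_m.-1 -> 'I_n}) (g : {ffun 'I_m.-1 -> 'I_m}) : Zt_frac :=
  \det (mxsub f g (alexander_matrix r e)).

(* Delta generates the ideal of Z[t, t^-1] spanned by the (m-1)-minors of the
   Alexander matrix. *)
Definition generates_alexander_ideal (m n : nat) (r : 'I_n -> word m)
    (e : 'I_m -> int) (Delta : Zt_frac) : Prop :=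
  (exists c : {ffun 'I_m.-1 -> 'I_n} -> {ffun 'I_m.-1 -> 'I_m} -> Zt_frac,
     (forall f g, is_laurent (c f g)) /\
     Delta = \sum_f \sum_g c f g * alexander_minor r e f g) /\
  (forall f g, exists q : Zt_frac,
     is_laurent q /\ alexander_minor r e f g = q * Delta).

(* Delta is a Laurent polynomial, Delta(t) = Delta(t^-1) and Delta(1) = 1. *)
Definition conway_normalized (Delta : Zt_frac) : Prop :=
  exists (p : {poly int}) (k : nat),
    [/\ Delta = laurent p k,
        Delta = (map_poly (intr : int -> Zt_frac) p).[tvar^-1] * tvar ^+ k
      & p.[1] = 1].

Definition is_alexander_polynomial (R : realType) (K : set 'rV[R]_4)
    (Delta : Zt_frac) : Prop :=
  conway_normalized Delta /\
  exists (x0 : 'rV[R]_4) (m n : nat) (gen : 'I_m -> R -> 'rV[R]_4)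
         (r : 'I_n -> word m) (e : 'I_m -> int),
    [/\ presents_pi1 (knot_complement K) x0 gen r,
        abelianization_to_Z r e
      & generates_alexander_ideal r e Delta].

(* The order of vanishing of a nonzero Laurent polynomial at z <> 0: the factor
   t^k does not contribute. *)
Definition zero_of_order (R : realType) (Delta : Zt_frac) (z : R[i]) (m : nat)
    : Prop :=
  exists (p : {poly int}) (k : nat),
    [/\ p != 0, Delta = laurent p k
      & mup z (map_poly (intr : int -> R[i]) p) = m].

(* Main.v *)
Require Import Defs.
From mathcomp Require Import all_boot all_order all_algebra.
From mathcomp Require Import algC algnum.
From mathcomp Require Import fraction complex polyrcf.
From mathcomp Require Import all_classical all_reals all_analysis.
From mathcomp Require Import ring lra zify.

Import Order.TTheory GRing.Theory Num.Theory.
Import numFieldNormedType.Exports.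

Local Open Scope classical_set_scope.
Local Open Scope ring_scope.

(** On the unit circle the Laurent polynomial is the real cosine polynomial
    g x = a_0 + 2 (a_1 cos x + ... + a_d cos (d x)), and g 0 = 1.

    If g takes a negative value, it changes sign, so it must have a zero of odd
    order.  Working with g itself would call for orders of vanishing of analytic
    functions; instead, z^k + z^-k is a polynomial in z + z^-1 (a Vieta-Lucas
    polynomial), so that Delta (z) = A (z + z^-1) with A in Z[X] and
    g x = A (2 cos x).  A real polynomial that changes sign on an interval has a
    root c of odd multiplicity inside it ([sign_change_odd_mup]), here with
    -2 < c < 2, and z |-> z + z^-1 is unramified over such c, so the
    multiplicity carries over to the two points z of the circle with
    z + z^-1 = c ([mup_joukowsky]).

    If g is nonnegative, the Egervary-Szasz inequality
    |a_j| <= a_0 cos (pi / N), with N = floor (d / j) + 2, holds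
    ([nonneg_cosine_coef_le]); it comes from pairing g with a nonnegative weight
    on equally spaced nodes that annihilates all coefficients except a_0 and
    a_j.  The assumed inequality then forces |a_j| = a_0 cos (pi / N), so that
    2 cos (pi / N) is rational.  It is also a root of a monic integer
    polynomial, hence an integer ([rational_two_cos_int]), and it lies strictly
    between 0 and 2; therefore it is 1 and a_0 = 2 |a_j|.  This is absurd, since
    a_0 + 2 (a_1 + ... + a_d) = 1 makes a_0 odd. *)

(** * Coefficients of nonnegative cosine polynomials *)

(** Each product cos y * (2 sin (h / 2)) is a difference of two values of sin at
    distance h. *)
Lemma sum_cos_telescope {R : realType} (x h : R) (M : nat) :
  (\sum_(m < M) cos (x + m%:R * h)) * (2 * sin (h / 2)) =
  sin (x + M%:R * h - h / 2) - sin (x - h / 2).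
Proof.
elim: M => [|M IHM]; first by rewrite big_ord0 !mul0r addr0 subrr.
rewrite big_ord_recr /= mulrDl IHM.
have -> : x + M.+1%:R * h - h / 2 = (x + M%:R * h) + h / 2.
  by rewrite -natr1; field.
set y := x + M%:R * h; rewrite (sinD y (h / 2)) (sinB y); ring.
Qed.

Lemma sum_cos_equidistributed {R : realType} (x : R) (k M : nat) :
  (0 < k < M)%N ->
  \sum_(m < M) cos (x + m%:R * (k%:R * (2 * pi / M%:R))) = 0.
Proof.
move=> /andP[k0 kM].
have M0 : (0 : R) < M%:R by rewrite ltr0n (ltn_trans k0).
set h := k%:R * _.
have hE : h / 2 = k%:R / M%:R * pi by rewrite /h; field; rewrite gt_eqF.
have /lt0r_neq0 s0 : 0 < sin (h / 2).
  apply: sin_gt0_pi; rewrite hE; apply/andP; split.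
    apply: mulr_gt0 (pi_gt0 R); apply: divr_gt0 M0; by rewrite ltr0n.
  by rewrite gtr_pMl ?pi_gt0// ltr_pdivrMr// mul1r ltr_nat.
have Mh : M%:R * h = pi *+ 2 *+ k.
  by rewrite /h -mulr_natr -[pi *+ 2]mulr_natr; field; rewrite gt_eqF.
have := sum_cos_telescope x h M.
have -> : x + M%:R * h - h / 2 = (x - h / 2) + pi *+ 2 *+ k by rewrite Mh; ring.
rewrite (periodicn (@sinD2pi R)) subrr => /eqP.
by rewrite mulf_eq0 mulf_eq0 pnatr_eq0 /= (negbTE s0) orbF => /eqP.
Qed.

(** The odd multiples of pi / N avoid the interior of the arc of half-width
    pi / N about the multiples of 2 pi. This is what makes the quadrature weight
    cos (pi / N) - cos (j x) nonnegative at every node. *)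
Lemma cos_odd_mul_le {R : realType} (N m : nat) : (0 < N)%N ->
  cos ((2 * m + 1)%:R * (pi / N%:R)) <= cos (pi / N%:R) :> R.
Proof.
move=> N0; have N0' : (0 : R) < N%:R by rewrite ltr0n.
set t := pi / N%:R.
have tN : N%:R * t = pi by rewrite /t; field; rewrite gt_eqF.
have sin_ge0 r : (r <= N)%N -> 0 <= sin (r%:R * t).
  move=> rN; apply: sin_ge0_pi; rewrite mulr_ge0 ?divr_ge0 ?pi_ge0//=.
  by rewrite -tN ler_wpM2r ?ler_nat ?divr_ge0 ?pi_ge0.
rewrite -subr_ge0.
have -> : cos t - cos ((2 * m + 1)%:R * t) =
    2 * (sin (m%:R * t) * sin (m.+1%:R * t)).
  set u := m%:R * t; set v := m.+1%:R * t.
  have -> : (2 * m + 1)%:R * t = u + v.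
    by rewrite /u /v -natr1 natrD natrM; ring.
  have -> : cos t = cos (v - u) by congr cos; rewrite /u /v -natr1; ring.
  by rewrite (cosB v u) (cosD u v); ring.
(* m t and (m + 1) t lie in the same interval [q pi, (q + 1) pi], so that
   their sines have the same sign (-1) ^ q. *)
have shift r : sin ((m %/ N * N + r)%:R * t) =
    (-1) ^+ (m %/ N) * sin (r%:R * t).
  have -> : (m %/ N * N + r)%:R * t = r%:R * t + pi *+ (m %/ N).
    rewrite natrD natrM mulrDl -mulrA tN addrC; congr (_ + _).
    by rewrite mulr_natl.
  elim: (m %/ N)%N => [|q IHq]; first by rewrite mulr0n addr0 mul1r.
  by rewrite mulrSr addrA sinDpi IHq exprS mulN1r mulNr.
have -> : m.+1 = (m %/ N * N + (m %% N).+1)%N by rewrite addnS -divn_eq.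
rewrite {1}(divn_eq m N) !shift mulrACA -expr2 sqrr_sign mul1r.
by rewrite !mulr_ge0 ?sin_ge0 ?ltn_pmod// ltnW ?ltn_pmod.
Qed.

(** The mean over M equally spaced nodes kills every frequency that is not a
    multiple of M.  The frequencies of cos (j x) * g x are j and, for
    1 <= k <= d, k + j and |k - j|; as d + j < M, only k = j leaves a constant
    term. *)
Lemma quadrature_coef {R : realType} (b : nat -> R) (al : R) (j d M : nat) :
  (0 < j <= d)%N -> (d + j < M)%N ->
  let phi m := al + m%:R * (2 * pi / M%:R) in
  let g x := b 0%N + 2 * \sum_(1 <= k < d.+1) b k * cos (k%:R * x) in
  \sum_(m < M) g (phi m) = M%:R * b 0%N /\
  \sum_(m < M) cos (j%:R * phi m) * g (phi m) = M%:R * b j.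
Proof.
move=> /andP[j0 jd] dM phi g.
have S0 k : (0 < k < M)%N -> \sum_(m < M) cos (k%:R * phi m) = 0.
  move=> kM; rewrite -[RHS](sum_cos_equidistributed (k%:R * al) k M kM).
  by apply: eq_bigr => m _; congr cos; rewrite /phi; ring.
split.
  rewrite big_split /= sumr_const card_ord -[RHS]addr0 mulr_natl; congr (_ + _).
  rewrite -mulr_sumr exchange_big /= big_nat big1 ?mulr0// => k kd.
  by rewrite -mulr_sumr S0 ?mulr0//; lia.
under eq_bigr do rewrite /g mulrDr.
rewrite big_split /= -mulr_suml S0 ?mul0r ?add0r; last by lia.
have -> : \sum_(m < M) cos (j%:R * phi m) *
      (2 * \sum_(1 <= k < d.+1) b k * cos (k%:R * phi m)) =
    \sum_(m < M) \sum_(1 <= k < d.+1) b k *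
      (cos ((k + j)%:R * phi m) + cos (k%:R * phi m - j%:R * phi m)).
  apply: eq_bigr => m _; rewrite mulrA mulr_sumr; apply: eq_bigr => k _.
  by rewrite natrD mulrDl cosD cosB; ring.
rewrite exchange_big /= (bigD1_seq j) ?mem_index_iota ?iota_uniq ?j0//=.
rewrite -mulr_sumr big_split /= S0; last by lia.
rewrite add0r; under eq_bigr do rewrite subrr cos0.
rewrite sumr_const card_ord -[RHS]addr0 mulrC; congr (_ + _).
rewrite big_nat_cond big1// => k /andP[kd kj].
rewrite -mulr_sumr big_split /= S0 ?add0r; last by lia.
have [jk|kj'] := leqP j k.
  under eq_bigr do rewrite -mulrBl -natrB//.
  by rewrite S0 ?mulr0//; move: kj kd jk; lia.
under eq_bigr do rewrite -cosN opprB -mulrBl -natrB ?(ltnW kj')//.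
by rewrite S0 ?mulr0//; move: kj kd kj'; lia.
Qed.

(** Egervary-Szasz inequality.  With N = d %/ j + 2 and M = N * j, the weight
    cos (pi / N) -+ cos (j x) is nonnegative at M suitable equally spaced nodes,
    and the weighted sum of the cosine polynomial over them is
    M * (b_0 cos (pi / N) -+ b_j) by [quadrature_coef]. *)
Lemma nonneg_cosine_coef_le {R : realType} (b : nat -> R) (j d : nat) :
  (0 < j <= d)%N ->
  (forall x, 0 <= b 0%N + 2 * \sum_(1 <= k < d.+1) b k * cos (k%:R * x)) ->
  `|b j| <= b 0%N * cos (pi / (d %/ j + 2)%:R).
Proof.
move=> jd g0; have /andP[j0 _] := jd.
set N := (d %/ j + 2)%N; set c := cos _; set M := (N * j)%N.
have dM : (d + j < M)%N.
  by rewrite /M /N mulnDl mul2n -addnn addnA ltn_add2r -mulSnr ltn_ceil.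
have N0 : (0 < N)%N by rewrite /N addn2.
have M0 : (0 : R) < M%:R by rewrite ltr0n; lia.
have j0' : (j%:R : R) != 0 by rewrite pnatr_eq0 -lt0n.
have N0' : (N%:R : R) != 0 by rewrite pnatr_eq0 -lt0n.
have bound (e al : R) :
    (forall m : nat, e * cos (j%:R * (al + m%:R * (2 * pi / M%:R))) <= c) ->
    e * b j <= b 0%N * c.
  move=> ec; have [S0 Sj] := quadrature_coef b al j d M jd dM.
  rewrite -subr_ge0 -(pmulr_rge0 _ M0).
  have -> : M%:R * (b 0%N * c - e * b j) = c * (M%:R * b 0%N) - e * (M%:R * b j).
    by ring.
  rewrite -S0 -Sj !mulr_sumr -sumrB sumr_ge0// => m _.
  by rewrite [e * (_ * _)]mulrA -mulrBl mulr_ge0 ?subr_ge0.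
have node (m : nat) : j%:R * (pi / M%:R + m%:R * (2 * pi / M%:R)) =
    (2 * m + 1)%:R * (pi / N%:R) :> R.
  by rewrite /M !natrM natrD natrM; field; apply/andP.
(* The nodes x = (2 m + 1) pi / M make j x an odd multiple of pi / N, which
   gives the upper bound; for the lower bound the nodes are moved by pi / j,
   which changes the sign of cos (j x). *)
rewrite ler_norml -lerNl; apply/andP; split.
  rewrite -mulN1r; apply: (bound _ (pi / M%:R + pi / j%:R)) => m.
  rewrite addrAC mulrDr node [j%:R * _]mulrC divfK// cosDpi mulrNN mul1r.
  exact: cos_odd_mul_le.
rewrite -[b j]mul1r; apply: (bound _ (pi / M%:R)) => m.
by rewrite node mul1r cos_odd_mul_le.
Qed.

(** * Multiplicities of roots *)

Lemma mup_factor {F : fieldType} {A : {poly F}} (c : F) : A != 0 ->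
  exists2 B, ~~ root B c & A = B * ('X - c%:P) ^+ mup c A.
Proof.
move=> A0; have [m [B]] := multiplicity_XsubC A c.
rewrite A0 /= => Bc AE; exists B => //.
by rewrite [in mup _ _]AE mupMr// mup_XsubCX eqxx.
Qed.

Lemma mup_map {F L : fieldType} (f : {rmorphism F -> L}) (A : {poly F}) c :
  A != 0 -> mup (f c) (map_poly f A) = mup c A.
Proof.
move=> A0; have [B Bc AE] := mup_factor c A0.
rewrite {1}AE rmorphM rmorphXn /= map_polyXsubC mupMr ?mup_XsubCX ?eqxx//.
by rewrite fmorph_root.
Qed.

(** A root of even multiplicity between x and y can be divided out without
    changing the signs at x and y, which lowers the degree. *)
Lemma sign_change_odd_mup {R : rcfType} (A : {poly R}) (x y : R) :
  x < y -> A.[x] < 0 -> 0 < A.[y] ->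
  exists2 c, x < c < y & odd (mup c A).
Proof.
have [n] := ubnP (size A); elim: n A => // n IHn A sA xy Ax Ay.
have A0 : A != 0 by apply: contraTneq Ax => ->; rewrite horner0 ltxx.
have [|c] := @poly_ivtoo R A x y (ltW xy); first by rewrite nmulr_rlt0.
rewrite in_itv /= => cxy Ac.
have [odd_c|even_c] := boolP (odd (mup c A)); first by exists c.
have [B Bc AE] := mup_factor c A0; set m := mup c A in AE even_c.
have B0 : B != 0 by apply: contra_neq A0; rewrite AE => ->; rewrite mul0r.
have m0 : (0 < m)%N by rewrite /m -XsubC_dvd// dvdp_XsubCl.
have pos w : w != c -> 0 < (w - c) ^+ m.
  by move=> wc; rewrite lt_def expf_neq0 ?subr_eq0//= exprn_even_ge0.
have AB w : A.[w] = B.[w] * (w - c) ^+ m.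
  by rewrite [in LHS]AE hornerM horner_exp hornerXsubC.
have /andP[xc cy] := cxy.
have [||||e exy odd_e] := IHn B.
- rewrite ltnS in sA; apply: leq_trans sA.
  rewrite [in X in (_ < X)%N]AE size_Mmonic ?monic_exp ?monicXsubC// size_exp_XsubC.
  by rewrite addnS -addn1 leq_add2l.
- exact: xy.
- by rewrite -(pmulr_llt0 _ (pos x _)) ?lt_eqF// -AB.
- by rewrite -(pmulr_lgt0 _ (pos y _)) ?gt_eqF// -AB.
exists e => //; rewrite AE mupMl//.
have ec : e != c.
  apply: contraTneq odd_e => ->; by rewrite mupNroot.
by rewrite /root horner_exp hornerXsubC expf_neq0 ?subr_eq0.
Qed.

(** * Multiplicities under z + 1 / z *)

Lemma eq_poly_off0 {F : numFieldType} (p q : {poly F}) :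
  (forall w, w != 0 -> p.[w] = q.[w]) -> p = q.
Proof.
move=> pq; apply/eqP; rewrite -subr_eq0; apply/eqP.
apply: (@roots_geq_poly_eq0 _ _ [seq n.+1%:R | n <- iota 0 (size (p - q)%R)]).
- apply/allP => _ /mapP[n _ ->].
  by rewrite /root hornerD hornerN pq ?subrr// pnatr_eq0.
- by rewrite map_inj_uniq ?iota_uniq// => x y /eqP; rewrite eqr_nat => /eqP[].
- by rewrite size_map size_iota.
Qed.

(** The polynomial X^n B (X + X^-1), written without denominators; this is the
    intended object when B has degree at most n. *)
Definition joukowsky_pullback {F : fieldType} (n : nat) (B : {poly F}) :=
  \sum_(i < n.+1) B`_i *: (('X^2 + 1) ^+ i * 'X^(n - i)).

Lemma horner_joukowsky_pullback {F : fieldType} (n : nat) (B : {poly F}) w :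
  w != 0 -> (size B <= n.+1)%N ->
  (joukowsky_pullback n B).[w] = w ^+ n * B.[w + w^-1].
Proof.
move=> w0 sB; rewrite (horner_coef_wide _ sB) horner_sum mulr_sumr.
apply: eq_bigr => i _.
rewrite hornerZ hornerM horner_exp !hornerE.
have -> : w ^+ 2 + 1 = w * (w + w^-1) by field.
have -> : w ^+ n = w ^+ (n - i) * w ^+ i by rewrite -exprD subnK// -ltnS.
by rewrite exprMn /=; ring.
Qed.

(** Since w + w^-1 - c = (w - z) (w - z^-1) / w for c = z + z^-1, the map
    z |-> z + z^-1 is unramified away from z = z^-1 and preserves
    multiplicities there. *)
Lemma mup_joukowsky {F : numFieldType} (n : nat) (P A : {poly F}) (z : F) :
  A != 0 -> (size A <= n.+1)%N ->
  (forall w, w != 0 -> P.[w] = w ^+ n * A.[w + w^-1]) ->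
  z != 0 -> z != z^-1 -> mup z P = mup (z + z^-1) A.
Proof.
move=> A0 sA PA z0 zV; set c := z + z^-1.
have [B Bc AE] := mup_factor c A0; set m := mup c A in AE *.
have B0 : B != 0 by apply: contra_neq A0; rewrite AE => ->; rewrite mul0r.
have sAB : size A = (size B + m)%N.
  rewrite AE size_Mmonic ?monic_exp ?monicXsubC// size_exp_XsubC.
  by rewrite addnS.
have mn : (m <= n)%N.
  by rewrite -ltnS (leq_trans _ sA)// sAB -add1n leq_add2r size_poly_gt0.
have sB : (size B <= (n - m).+1)%N by move: sA mn; rewrite sAB; lia.
have -> : P = ('X - z%:P) ^+ m * (('X - z^-1%:P) ^+ m * joukowsky_pullback (n - m) B).
  apply: eq_poly_off0 => w w0; rewrite PA// AE !hornerM !horner_exp.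
  rewrite horner_joukowsky_pullback// !hornerXsubC -{1}(subnK mn) exprD.
  rewrite mulrA -exprMn; set Bw := B.[_].
  have -> : (w - z) * (w - z^-1) = w * (w + w^-1 - c) by rewrite /c; field; apply/andP.
  by rewrite exprMn; ring.
rewrite mupMl ?mup_XsubCX ?eqxx//.
rewrite /root hornerM horner_exp hornerXsubC horner_joukowsky_pullback//.
by rewrite !mulf_neq0// expf_neq0// subr_eq0.
Qed.

(** * Vieta-Lucas polynomials and rational values of the cosine *)

(** Twice the Chebyshev polynomial T_n evaluated at X / 2.  This rescaling is
    monic, which is what the integrality argument for 2 cos (pi / N) needs. *)
Fixpoint vieta_lucas (n : nat) : {poly int} :=
  match n with
  | 0 => 2
  | n'.+1 => if n' is n''.+1 then 'X * vieta_lucas n' - vieta_lucas n'' else 'X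
  end.

Arguments vieta_lucas : simpl never.

Lemma vieta_lucasSS n :
  vieta_lucas n.+2 = 'X * vieta_lucas n.+1 - vieta_lucas n.
Proof. by []. Qed.

Lemma vieta_lucas_size_monic n :
  size (vieta_lucas n) = n.+1 /\ ((0 < n)%N -> vieta_lucas n \is monic).
Proof.
elim/ltn_ind: n => -[|[|n]] IHn.
- by split; rewrite // /vieta_lucas -polyC_natr size_polyC.
- by split; rewrite /vieta_lucas ?size_polyX ?monicX.
have [sn _] := IHn n (ltnW (ltnSn _)); have [sn1 mn1] := IHn n.+1 (ltnSn _).
rewrite vieta_lucasSS mulrC.
have sX : size (vieta_lucas n.+1 * 'X) = n.+3.
  by rewrite size_mulX ?sn1// -size_poly_eq0 sn1.
split; first by rewrite size_polyDl sX// size_polyN sn.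
by rewrite monicE lead_coefDl ?size_polyN ?sn ?sX// lead_coefMX (monicP (mn1 _)).
Qed.

Lemma vieta_lucas_addV {F : fieldType} (w : F) n : w != 0 ->
  (map_poly intr (vieta_lucas n)).[w + w^-1] = w ^+ n + w ^- n.
Proof.
move=> w0; elim/ltn_ind: n => -[|[|n]] IHn.
- by rewrite /vieta_lucas rmorph_nat -polyC_natr hornerC !expr0 invr1.
- by rewrite /vieta_lucas map_polyX hornerX !expr1.
rewrite vieta_lucasSS rmorphB rmorphM /= map_polyX !hornerE !IHn//.
rewrite !exprS; move: (expf_neq0 n w0); set u := w ^+ n => u0.
by field; rewrite ?w0 ?u0.
Qed.

Lemma vieta_lucas_cos {R : realType} (x : R) n :
  (map_poly intr (vieta_lucas n)).[2 * cos x] = 2 * cos (n%:R * x).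
Proof.
elim/ltn_ind: n => -[|[|n]] IHn.
- by rewrite /vieta_lucas rmorph_nat -polyC_natr hornerC mul0r cos0 mulr1.
- by rewrite /vieta_lucas map_polyX hornerX mul1r.
rewrite vieta_lucasSS rmorphB rmorphM /= map_polyX !hornerE !IHn//.
have -> : n.+2%:R * x = n.+1%:R * x + x by rewrite -(natr1 n.+1); ring.
have -> : cos (n%:R * x) = cos (n.+1%:R * x - x) by congr cos; rewrite -natr1; ring.
by rewrite (cosD _ x) (cosB _ x); ring.
Qed.

Lemma monic_int_ratroot (p : {poly int}) (q : rat) :
  p \is monic -> root (map_poly intr p) q -> exists n : int, q = n%:~R.
Proof.
move=> p_monic pq.
have q_Aint : (ratr q : algC) \in Aint.
  apply: (@root_monic_Aint (map_poly intr p)).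
  - rewrite -(fmorph_root (ratr : rat -> algC)) -map_poly_comp in pq.
    by rewrite (eq_map_poly (g := ratr \o intr))// => n /=; rewrite ratr_int.
  - exact: monic_map.
  - by apply/polyOverP => i; rewrite coef_map /= intr_int.
have /intrP[n qn] := Cint_rat_Aint (Crat_rat q) q_Aint.
by exists n; apply: (fmorph_inj (ratr : rat -> algC)); rewrite /= qn ratr_int.
Qed.

(** 2 cos (pi / N) is an algebraic integer: it is a root of the monic polynomial
    vieta_lucas N + 2, because 2 cos pi = -2. *)
Lemma rational_two_cos_int {R : realType} (N : nat) (q : rat) : (0 < N)%N ->
  2 * cos (pi / N%:R) = ratr q :> R -> exists n : int, q = n%:~R.
Proof.
move=> N0 qE; have N0' : (N%:R : R) != 0 by rewrite pnatr_eq0 -lt0n.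
have [sN mN] := vieta_lucas_size_monic N.
apply: (@monic_int_ratroot (vieta_lucas N + 2)).
  rewrite monicE lead_coefDl -?monicE ?mN// sN -polyC_natr.
  by rewrite (leq_ltn_trans (size_polyC_leq1 _)).
rewrite -(fmorph_root (ratr : rat -> R)) -map_poly_comp.
have /eq_map_poly -> : (ratr : rat -> R) \o intr =1 intr by move=> n /=; rewrite ratr_int.
rewrite /= -qE /root rmorphD hornerD vieta_lucas_cos [_ * (pi / _)]mulrC divfK// cospi.
by rewrite rmorph_nat -polyC_natr hornerC mulrN1 addNr.
Qed.

(** * Zeros on the unit circle *)

(** t^d Delta (t). *)
Definition symmetric_poly (d : nat) (a : nat -> int) : {poly int} :=
  a 0%N *: 'X^d + \sum_(1 <= k < d.+1) a k *: ('X^(d + k) + 'X^(d - k)).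

(** The polynomial A with Delta (t) = A (t + t^-1). *)
Definition chebyshev_form (d : nat) (a : nat -> int) : {poly int} :=
  (a 0%N)%:P + \sum_(1 <= k < d.+1) a k *: vieta_lucas k.

Lemma laurent_symmetric_poly (d : nat) (a : nat -> int) :
  laurent (symmetric_poly d a) d =
  (a 0%N)%:~R + \sum_(1 <= k < d.+1) (a k)%:~R * (tvar ^+ k + tvar ^- k).
Proof.
have t0 : tvar != 0 by rewrite tofrac_eq0 polyX_eq0.
have scale (c : int) (p : {poly int}) :
    FracField.tofrac (c *: p) = c%:~R * FracField.tofrac p.
  by rewrite -mul_polyC tofracM -[c in c%:P]intz polyCMz rmorph_int.
rewrite /laurent /symmetric_poly tofracD mulrDl scale tofracXn mulfK ?expf_neq0//.
congr (_ + _); rewrite rmorph_sum mulr_suml; apply: eq_big_nat => k /andP[_ kd].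
rewrite /= scale -mulrA; congr (_ * _); rewrite tofracD !tofracXn -/tvar mulrDl.
rewrite exprD mulrAC mulfV ?expf_neq0// mul1r; congr (_ + _).
rewrite -[in X in _ / X](subnK (n := d) (m := k)) -1?ltnS// exprD.
by rewrite invfM mulrA mulfV ?expf_neq0// mul1r.
Qed.

Lemma horner_symmetric_poly {F : fieldType} (d : nat) (a : nat -> int) (w : F) :
  w != 0 -> (map_poly intr (symmetric_poly d a)).[w] =
  w ^+ d * (map_poly intr (chebyshev_form d a)).[w + w^-1].
Proof.
move=> w0; rewrite /symmetric_poly /chebyshev_form !rmorphD !hornerD mulrDr /=.
rewrite !rmorph_sum !horner_sum mulr_sumr map_polyZ map_polyXn hornerZ hornerXn.
rewrite map_polyC hornerC mulrC; congr (_ + _).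
apply: eq_big_nat => k /andP[_ kd].
rewrite /= !map_polyZ rmorphD /= !map_polyXn !hornerZ hornerD !hornerXn.
rewrite vieta_lucas_addV// mulrCA.
congr (_ * _); rewrite exprD mulrDr; congr (_ + _).
rewrite -[in X in _ = X * _](subnK (n := d) (m := k)) -1?ltnS// exprD.
by rewrite mulfK ?expf_neq0.
Qed.

Lemma size_chebyshev_form (d : nat) (a : nat -> int) :
  (size (chebyshev_form d a) <= d.+1)%N.
Proof.
apply: (leq_trans (size_polyD _ _)); rewrite geq_max.
rewrite (leq_trans (size_polyC_leq1 _))//=.
apply: (leq_trans (size_sum _ _ _)); apply/bigmax_leqP_seq => k.
rewrite mem_index_iota => /andP[_ kd] _.
by rewrite (leq_trans (size_scale_leq _ _))// (vieta_lucas_size_monic k).1.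
Qed.

Lemma chebyshev_form_cos {R : realType} (d : nat) (a : nat -> int) (x : R) :
  (map_poly intr (chebyshev_form d a)).[2 * cos x] =
  (a 0%N)%:~R + 2 * \sum_(1 <= k < d.+1) (a k)%:~R * cos (k%:R * x).
Proof.
rewrite /chebyshev_form rmorphD hornerD /= map_polyC hornerC /=; congr (_ + _).
rewrite rmorph_sum horner_sum mulr_sumr; apply: eq_bigr => k _.
by rewrite /= map_polyZ hornerZ vieta_lucas_cos mulrCA.
Qed.

(** Evaluation at t = 1 does not depend on the chosen numerator: two numerators
    differ by a power of t. *)
Lemma laurent_horner1 (p q : {poly int}) (k l : nat) :
  laurent p k = laurent q l -> p.[1] = q.[1].
Proof.
have t0 : tvar != 0 by rewrite tofrac_eq0 polyX_eq0.
rewrite /laurent => /eqP; rewrite eqr_div ?expf_neq0// -!tofracXn -!tofracM.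
rewrite tofrac_eq => /eqP/(congr1 (horner^~ 1)).
by rewrite !hornerM !hornerXn !expr1n !mulr1.
Qed.

Lemma symmetric_poly_horner1 (d : nat) (a : nat -> int) :
  (symmetric_poly d a).[1] = a 0%N + 2 * \sum_(1 <= k < d.+1) a k.
Proof.
rewrite /symmetric_poly hornerD horner_sum hornerZ hornerXn expr1n mulr1.
congr (_ + _); rewrite mulr_sumr; apply: eq_bigr => k _.
by rewrite hornerZ hornerD !hornerXn !expr1n mulrC.
Qed.

(** A (2) = Delta (1) = 1 > 0 and A (2 cos x) < 0, so that A has a root c of odd
    multiplicity in the open interval between 2 cos x and 2.  The points z of the
    unit circle over c have real part c / 2 and are not real, hence z != z^-1. *)
Lemma odd_zero_of_negative_value {R : realType} (d : nat) (a : nat -> int) (x : R) :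
  (symmetric_poly d a).[1] = 1 ->
  (a 0%N)%:~R + 2 * \sum_(1 <= k < d.+1) (a k)%:~R * cos (k%:R * x) < 0 ->
  exists z : R[i], `|z| = 1 /\
    odd (mup z (map_poly intr (symmetric_poly d a))).
Proof.
move=> p1; rewrite -chebyshev_form_cos => A_neg.
set AZ := chebyshev_form d a in A_neg *.
set A := map_poly intr AZ in A_neg.
have A2 : A.[2] = 1.
  have := @horner_symmetric_poly R d a 1 (oner_neq0 _).
  rewrite invr1 expr1n mul1r -[1 + 1]/(2 : R) => <-.
  by rewrite -[RHS](congr1 intr p1) -horner_map.
have x2 : 2 * cos x < 2.
  rewrite lt_neqAle; apply/andP; split; last by have := cos_le1 x; lra.
  by apply: contraTneq A_neg => ->; rewrite A2 ltr10.
have [|c /andP[xc c2] odd_c] := sign_change_odd_mup A _ _ x2 A_neg.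
  by rewrite A2.
have c2' : -2 < c by have := cos_geN1 x; lra.
set s := Num.sqrt (1 - (c / 2) ^+ 2).
have s2 : s ^+ 2 = 1 - (c / 2) ^+ 2 by rewrite sqr_sqrtr//; nra.
have s0 : s != 0 by rewrite -sqrf_eq0 s2 gt_eqF//; nra.
pose z : R[i] := Complex (c / 2) s.
have z1 : `|z| = 1.
  by rewrite normc_def /= s2 addrC subrK sqrtr1.
have z0 : z != 0 by rewrite -normr_eq0 z1 oner_eq0.
have zV : z^-1 = Complex (c / 2) (- s).
  apply: (mulfI z0); rewrite mulfV//; apply/eqP; rewrite eq_complex /=.
  by apply/andP; split; apply/eqP; rewrite ?mulrN ?opprK -?expr2 ?s2; ring.
have zc : z + z^-1 = c%:C%C.
  by rewrite zV; apply/eqP; rewrite eq_complex /= subrr eqxx andbT -splitr.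
have A0 : A != 0 by apply: contraTneq A_neg => ->; rewrite horner0 ltxx.
exists z; split=> //.
have AC : map_poly intr AZ = map_poly (real_complex R) A :> {poly R[i]}.
  by rewrite -map_poly_comp; apply: eq_map_poly => n /=; rewrite rmorph_int.
rewrite (@mup_joukowsky _ d _ (map_poly intr AZ)).
- by rewrite zc AC mup_map.
- by rewrite AC map_poly_eq0.
- by rewrite AC size_map_poly (leq_trans (size_poly _ _)) ?size_chebyshev_form.
- by move=> w w0; exact: horner_symmetric_poly.
- exact: z0.
- rewrite zV; apply/eqP => -[ss]; move/eqP: s0; apply; lra.
Qed.

Theorem theorem1p3 (R : realType) (K : set 'rV[R]_4) (Delta : Zt_frac)
    (d : nat) (a : nat -> int)
    (hK : is_knot K)
    (hDelta : is_alexander_polynomial K Delta)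
    (ha : Delta = (a 0%N)%:~R
            + \sum_(1 <= k < d.+1) (a k)%:~R * (tvar ^+ k + tvar ^- k))
    (hineq : exists j : nat, (1 <= j <= d)%N /\
       `|a 0%N|%:~R * cos (pi / (d %/ j + 2)%:R) <= `|a j|%:~R :> R) :
  exists z : R[i], `|z| = 1 /\
    exists m : nat, odd m /\ zero_of_order Delta z m.
Proof.
have DeltaE : Delta = laurent (symmetric_poly d a) d.
  by rewrite laurent_symmetric_poly.
have p1 : (symmetric_poly d a).[1] = 1.
  have [[p [k [Dp _ pE]]] _] := hDelta.
  by rewrite -[RHS]pE; apply: (@laurent_horner1 _ _ d k); rewrite -DeltaE.
have p0 : symmetric_poly d a != 0.
  by apply: contra_eq_neq p1 => ->; rewrite horner0 eq_sym oner_eq0.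
pose g (x : R) :=
  (a 0%N)%:~R + 2 * \sum_(1 <= k < d.+1) (a k)%:~R * cos (k%:R * x).
have [[x gx]|g_ge0] := pselect (exists x, g x < 0).
  have [z [z1 odd_z]] := odd_zero_of_negative_value d a x p1 gx.
  by exists z; split=> //; eexists; split; [exact: odd_z|exists (symmetric_poly d a), d].
exfalso.
have {}g_ge0 x : 0 <= g x by rewrite leNgt; apply/negP => gx; apply: g_ge0; exists x.
have [j [jd aj]] := hineq; set N := (d %/ j + 2)%N in aj.
have := nonneg_cosine_coef_le (fun k => (a k)%:~R) j d jd g_ge0.
rewrite -/N; set c := cos _ in aj * => aj'.
have N3 : (3 <= N)%N by rewrite /N addn2 !ltnS divn_gt0; lia.
have N0 : (0 : R) < N%:R by rewrite ltr0n (ltn_trans _ N3).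
have piN : 0 < (pi : R) / N%:R < (pi : R) / 2.
  apply/andP; split; first exact: divr_gt0 (pi_gt0 R) N0.
  rewrite (ltr_pM2l (pi_gt0 R)) ltf_pV2 ?posrE//.
  by rewrite ltr_nat.
have c_gt0 : 0 < c.
  by rewrite cos_gt0_pihalf//; have := pi_gt0 R; lra.
have c_lt1 : c < 1.
  by rewrite -(cos0 R) ltr_cos ?in_itv/=; have := pi_gt0 R; lra.
have a0_ge0 : 0 <= (a 0%N)%:~R * c := le_trans (normr_ge0 _) aj'.
have {}a0_ge0 : 0 <= a 0%N by rewrite -(ler0z R) -(pmulr_lge0 _ c_gt0).
have ajE : (a 0%N)%:~R * c = `|a j|%:~R.
  apply/eqP; rewrite eq_le; rewrite ger0_norm// in aj; rewrite aj /=.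
  by rewrite intr_norm.
have a0_odd : a 0%N = 1 - 2 * \sum_(1 <= k < d.+1) a k.
  by have := symmetric_poly_horner1 d a; rewrite p1; lia.
have a0_neq0 : a 0%N != 0 by apply/eqP; move: a0_odd; lia.
have cE : 2 * c = ratr ((2 * `|a j|)%:~R / (a 0%N)%:~R).
  rewrite fmorph_div /= !ratr_int rmorphM /= -ajE.
  by field; rewrite intr_eq0.
(* Being rational, 2 c is an integer; it lies in the open interval (0, 2). *)
have [|n nE] := rational_two_cos_int N _ _ cE; first by lia.
move: cE; rewrite nE ratr_int => cE.
have n1 : n = 1.
  have : 0 < n < 2 by rewrite -(ltr0z R) -(ltr_int R) -cE; lra.
  lia.
have : a 0%N = 2 * `|a j|.
  apply: (@intr_inj R); rewrite rmorphM /= -ajE.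
  have -> : c = 2^-1 by move: cE; rewrite n1; lra.
  by field.
by move: a0_odd; lia.
Qed.
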